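(* Let $\mathsf{T}$ be the theory whose states are all density matrices, whose effects are the Hermitian operators $E$ with $0\le \Gamma_S(E)\le \mathbb{I}$ for every subset $S$ of wires, and whose operations are the completely PPT-preserving maps, and let $\mathsf{sT}$ be its subtheory invariant under complex conjugation (precise definitions in the context). Let a causal structure be given, in which each wire is permitted to carry a reference-frame register (a qubit) emitted by the source of that wire and held by whichever party holds that wire. Then $$\mathrm{corr}_{\mathsf{T}}=\mathrm{corr}_{\mathsf{sT}}$$ in that causal structure. In particular, there is no causal structure in which the inclusion $\mathrm{corr}_{\mathsf{sT}}\subseteq\mathrm{corr}_{\mathsf{T}}$ is strict.
   Context: **Wires and partial transposition.** A wire carries a finite-dimensional complex Hilbert space with a fixed orthonormal basis. A system is a finite list of wires, composed by the ordinary tensor product. For a subset $S$ of the wires of a system, $\Gamma_S$ denotes partial transposition (in the fixed bases) on the wires in $S$. Complex conjugation $C$ in the fixed bases acts on Hermitian operators as the full transpose. **Labels.** A linear map $\Lambda:\mathcal L(\mathcal H_{\rm in})\to\mathcal L(\mathcal H_{\rm out})$ has its input and output wires labelled by a common index set, each label occurring on at most one input wire and at most one output wire. For a set $V$ of labels, $\Gamma_V\circ\Lambda\circ\Gamma_V$ means: transpose the input wires with label in $V$, apply $\Lambda$, then transpose the output wires with label in $V$. Permuting wires is part of the wiring, not an operation. **The theory $\mathsf T$.** States: all density matrices on every system. Effects: $\mathcal E=\{E \text{ Hermitian}: 0\le\Gamma_S(E)\le\mathbb I \text{ for all subsets } S \text{ of the wires}\}$. A measurement is a finite family of effects summing to $\mathbb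 I$. Operations: $\mathcal O$ = trace-preserving linear maps $\Lambda$ such that $\Gamma_V\circ\Lambda\circ\Gamma_V$ is completely positive for every set $V$ of labels. Instruments are also allowed: finite families $\{\Lambda_k\}$ of trace-non-increasing maps with $\Gamma_V\Lambda_k\Gamma_V$ completely positive for all $V$ and all $k$, and $\sum_k\Lambda_k\in\mathcal O$. **The theory $\mathsf{sT}$.** States: the real density matrices. Effects: the real elements of $\mathcal E$. Operations (and elements of instruments): those of $\mathsf T$ that commute with $C$. **Causal structures and correlations.** A causal structure is a finite directed acyclic graph whose nodes are sources (no incoming edges), intermediate boxes (at least one incoming edge) and parties (no outgoing edges), together with finite sets of setting values and outcome values (possibly trivial) for each box and party and a specification of which settings and which earlier outcomes each box or party may depend on. A realisation in a theory $X$ assigns: to each edge a finite list of wires of arbitrary finite dimensions (so that an edge may carry, alongside a system wire, a frame register travelling with it); to each source a state of $X$ on the wires of its outgoing edges (independent sources emit product states); to each box, for each value of the classical data it sees, an instrument of $X$ from its incoming wires (at least one) to its outgoing wires, indexed by its outcome; to each party, for each value of the classical data it sees, a measurement of $X$ on its incoming wires, indexed by its outcome. Labels are consistent along edges: the two ends of an edge carry the same wires with the same labels. $\mathrm{corr}_X$ is the set of conditional distributions $P(\text{outcomes}\mid\text{settings})$ given by the trace rule for some realisation in $X$. *)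

(* Defs.v *)
From HB Require Import structures.
From mathcomp Require Import all_boot all_order all_algebra.
From mathcomp Require Import complex.
From mathcomp Require Import boolp classical_sets reals.

Set Implicit Arguments.
Unset Strict Implicit.
Unset Printing Implicit Defensive.

Import Order.TTheory GRing.Theory Num.Theory.
Local Open Scope ring_scope.
Local Open Scope complex_scope.
Local Open Scope sesquilinear_scope.

(** Dependent families over a finite index type, and over a subset of it. *)

Definition fam (I : finType) (T : I -> finType) : finType :=
  {dffun forall i : I, T i}.

Definition subfam (I : finType) (T : I -> finType) (A : {set I}) : finType :=
  {dffun forall i : {i : I | i \in A}, T (val i)}.

Definition restr (I : finType) (T : I -> finType) (A : {set I}) (f : fam T) :
    subfam T A :=
  finfun (fun i : {i : I | i \in A} => f (val i)).

(** Operators on a system.  [W] is the type of all wires of a network and [d]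
    gives their dimensions.  A system is a set [D] of wires; the product basis
    of its Hilbert space is indexed by [idx d D], and matrices are indexed by
    the enumeration of that type. *)

Definition idx (W : finType) (d : W -> nat) (D : {set W}) : finType :=
  subfam (fun w => 'I_(d w) : finType) D.

Definition op (R : realType) (W : finType) (d : W -> nat) (D : {set W}) :=
  'M[R[i]]_(#|idx d D|).

Definition entry (R : realType) (W : finType) (d : W -> nat) (D : {set W})
    (A : op R d D) (k l : idx d D) : R[i] :=
  A (enum_rank k) (enum_rank l).

Definition opmx (R : realType) (W : finType) (d : W -> nat) (D : {set W})
    (f : idx d D -> idx d D -> R[i]) : op R d D :=
  \matrix_(i, j) f (enum_val i) (enum_val j).

(** The matrix unit |k><l|. *)
Definition matunit (R : realType) (W : finType) (d : W -> nat) (D : {set W})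
    (k l : idx d D) : op R d D :=
  delta_mx (enum_rank k) (enum_rank l).

(** [mix S k l] agrees with [l] on the wires in [S] and with [k] elsewhere. *)
Definition mix (W : finType) (d : W -> nat) (D S : {set W}) (k l : idx d D) :
    idx d D :=
  finfun (fun w : {w : W | w \in D} => if val w \in S then l w else k w).

(** Partial transposition on the wires of [D] that lie in [S]. *)
Definition ptrans (R : realType) (W : finType) (d : W -> nat) (D S : {set W})
    (A : op R d D) : op R d D :=
  opmx (fun k l => entry A (mix S k l) (mix S l k)).

(** In [R[i]], [0 <= z] means that [z] is real and nonnegative. *)
Definition psd (R : realType) (n : nat) (A : 'M[R[i]]_n) : Prop :=
  A \is hermsymmx /\ forall v : 'cV[R[i]]_n, 0 <= (v^t* *m A *m v) 0 0.

(** An operator on C^k (x) C^m is a k-by-k block matrix with blocks of size m,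
    and id_k (x) Lam acts on it blockwise. *)
Definition completely_positive (R : realType) (m n : nat)
    (Lam : 'M[R[i]]_m -> 'M[R[i]]_n) : Prop :=
  forall (k : nat) (X : 'I_k -> 'I_k -> 'M[R[i]]_m),
    psd (\mxblock_(a < k, b < k) X a b) ->
    psd (\mxblock_(a < k, b < k) Lam (X a b)).

Definition trace_preserving (R : realType) (m n : nat)
    (Lam : 'M[R[i]]_m -> 'M[R[i]]_n) : Prop :=
  forall X, \tr (Lam X) = \tr X.

Definition trace_nonincreasing (R : realType) (m n : nat)
    (Lam : 'M[R[i]]_m -> 'M[R[i]]_n) : Prop :=
  forall X, psd X -> \tr (Lam X) <= \tr X.

(** Gamma_V o Lam o Gamma_V, for a set [V] of labels. *)
Definition gamma_conj (R : realType) (W L : finType) (d : W -> nat)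
    (lab : W -> L) (D D' : {set W}) (V : {set L})
    (Lam : op R d D -> op R d D') : op R d D -> op R d D' :=
  fun X => ptrans [set w | lab w \in V]
             (Lam (ptrans [set w | lab w \in V] X)).

Definition completely_PPT (R : realType) (W L : finType) (d : W -> nat)
    (lab : W -> L) (D D' : {set W}) (Lam : op R d D -> op R d D') : Prop :=
  linear Lam /\ forall V : {set L}, completely_positive (gamma_conj lab V Lam).

(** Complex conjugation in the fixed bases. *)
Definition commutes_with_conj (R : realType) (W : finType) (d : W -> nat)
    (D D' : {set W}) (Lam : op R d D -> op R d D') : Prop :=
  forall X : op R d D, Lam (map_mx Num.conj X) = map_mx Num.conj (Lam X).

Inductive theory := T | sT.

Definition is_state (R : realType) (th : theory) (W : finType) (d : W -> nat)
    (D : {set W}) (rho : op R d D) : Prop :=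
  [/\ psd rho, \tr rho = 1 & if th is sT then rho \is a realmx else True].

Definition is_effect (R : realType) (th : theory) (W : finType) (d : W -> nat)
    (D : {set W}) (E : op R d D) : Prop :=
  [/\ E \is hermsymmx,
      forall S : {set W}, psd (ptrans S E) /\ psd (1%:M - ptrans S E)
    & if th is sT then E \is a realmx else True].

Definition is_measurement (R : realType) (th : theory) (W : finType)
    (d : W -> nat) (D : {set W}) (O : finType) (E : O -> op R d D) : Prop :=
  (forall o, is_effect th (E o)) /\ \sum_o E o = 1%:M.

Definition is_operation (R : realType) (th : theory) (W L : finType)
    (d : W -> nat) (lab : W -> L) (D D' : {set W})
    (Lam : op R d D -> op R d D') : Prop :=
  [/\ completely_PPT lab Lam, trace_preserving Lam
    & if th is sT then commutes_with_conj Lam else True].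

Definition is_instrument (R : realType) (th : theory) (W L : finType)
    (d : W -> nat) (lab : W -> L) (D D' : {set W}) (O : finType)
    (Lam : O -> op R d D -> op R d D') : Prop :=
  (forall o, [/\ completely_PPT lab (Lam o), trace_nonincreasing (Lam o)
               & if th is sT then commutes_with_conj (Lam o) else True])
  /\ is_operation th lab (fun X => \sum_o Lam o X).

(** Agents are the nodes that carry classical data: boxes and parties.  A
    setting variable and an outcome variable sit at every agent;
    [sees_setting a] and [sees_outcome a] list the agents whose setting,
    respectively outcome, is available at [a].  An outcome may be used at an
    agent that is not its descendant along the arrows (parties have no
    outgoing arrow); that it is an earlier one is expressed by requiring the
    arrows and the outcome dependencies to be acyclic together. *)

Definition acyclic (V : finType) (e : rel V) : Prop :=
  forall u v, e u v -> ~~ connect e v u.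

Definition signals (src agt : finType) (sees : agt -> {set agt}) :
    rel (src + agt) :=
  fun u v => match u, v with inr a, inr b => a \in sees b | _, _ => false end.

Record causal_structure := CausalStructure {
  source : finType;
  box : finType;
  party : finType;
  agent : finType := (box + party)%type;
  node : finType := (source + agent)%type;
  arrow : rel node;
  setting : agent -> finType;
  outcome : agent -> finType;
  sees_setting : agent -> {set agent};
  sees_outcome : agent -> {set agent};
  source_no_incoming : forall (u : node) (s : source), ~~ arrow u (inl s);
  box_incoming : forall b : box, exists u : node, arrow u (inr (inl b));
  party_no_outgoing : forall (p : party) (v : node), ~~ arrow (inr (inr p)) v;
  arrows_acyclic : acyclic (relU arrow (signals sees_outcome))
}.

Definition data (G : causal_structure) (a : agent G) : finType :=
  (subfam (@setting G) (sees_setting a) * subfam (@outcome G) (sees_outcome a))%type.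

Definition seen (G : causal_structure) (a : agent G)
    (x : fam (@setting G)) (o : fam (@outcome G)) : data a :=
  (restr (sees_setting a) x, restr (sees_outcome a) o).

(** The wires on the edge from [u] to [v] are the [w] with [tail w = u] and
    [head w = v]; each wire, hence both of its ends, has one label. *)
Record realisation (R : realType) (th : theory) (G : causal_structure) :=
  Realisation {
  wire : finType;
  label : finType;
  dim : wire -> nat;
  lab : wire -> label;
  tail : wire -> node G;
  head : wire -> node G;
  inw : node G -> {set wire} := fun v => [set w | head w == v]%SET;
  outw : node G -> {set wire} := fun v => [set w | tail w == v]%SET;
  prep : forall s : source G, op R dim (outw (inl s));
  inst : forall b : box G, data (inl b : agent G) -> outcome (inl b : agent G) ->
    op R dim (inw (inr (inl b))) -> op R dim (outw (inr (inl b)));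
  meas : forall p : party G, data (inr p : agent G) ->
    outcome (inr p : agent G) -> op R dim (inw (inr (inr p)));
  wire_arrow : forall w, arrow (tail w) (head w);
  box_wire : forall b : box G, inw (inr (inl b)) != finset.set0;
  lab_in : forall b : box G, {in inw (inr (inl b)) &, injective lab};
  lab_out : forall b : box G, {in outw (inr (inl b)) &, injective lab};
  prep_state : forall s, is_state th (prep s);
  inst_instrument : forall b t, is_instrument th lab (inst (b := b) t);
  meas_measurement : forall p t, is_measurement th (meas (p := p) t)
}.

Arguments prep {R th G} r s.
Arguments inst {R th G} r {b} t o X.
Arguments meas {R th G} r {p} t o.

(** The trace rule, i.e. the trace of the product of the source states, passed
    through the boxes and then paired with the effects.  It is written by
    inserting, on every wire [w], the expansion of the operator carried by [w]
    in the matrix units |k w><l w|: a source contributes the coefficient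
    <k|rho|l>, a box the coefficient at |k_out><l_out| of the image of
    |k_in><l_in|, and a party the trace of its effect against |k_in><l_in|. *)
Definition prob (R : realType) (th : theory) (G : causal_structure)
    (r : realisation R th G) (x : fam (@setting G)) (o : fam (@outcome G)) :
    R[i] :=
  \sum_(k : fam (fun w : wire r => 'I_(dim w) : finType))
  \sum_(l : fam (fun w : wire r => 'I_(dim w) : finType))
    (\prod_(s : source G)
       entry (prep r s) (restr (outw r (inl s)) k) (restr (outw r (inl s)) l)) *
    (\prod_(b : box G)
       entry (inst r (seen (inl b) x o) (o (inl b))
                (matunit R (restr (inw r (inr (inl b))) k)
                           (restr (inw r (inr (inl b))) l)))
             (restr (outw r (inr (inl b))) k)
             (restr (outw r (inr (inl b))) l)) *
    (\prod_(p : party G)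
       \tr (meas r (seen (inr p) x o) (o (inr p)) *m
              matunit R (restr (inw r (inr (inr p))) k)
                        (restr (inw r (inr (inr p))) l))).

(** [P x o] is the probability of the outcomes [o] given the settings [x]. *)
Definition corr (R : realType) (th : theory) (G : causal_structure) :
    set (fam (@setting G) -> fam (@outcome G) -> R) :=
  [set P | exists r : realisation R th G, forall x o, (P x o)%:C = prob r x o]%classic.

Arguments corr R th G : clear implicits.

(* Main.v *)
(** Every wire is doubled by a frame qubit.  The isometry J : v |-> v (x) |+i> and
    its conjugate v |-> v (x) |-i> have orthogonal ranges, so the qubit stores one
    bit, telling whether the operator on the wire is to be read directly or
    transposed; conjugation flips all the bits.  An operator A whose wires in S
    have bit 1 is encoded as Gamma_S (J A J^* ), which equals
    J_S Gamma_S(A) J_S^* for an isometry J_S.  The new sources emit all their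
    wires with one common random bit, and the new boxes and parties read the bits
    of their incoming wires and apply the corresponding partial transpose of
    their map or effect, which the definition of the theory makes positive;
    averaging over the bits makes everything real.  In the trace rule, the bits
    written and read on a wire must agree by orthogonality, and a transposition
    at both ends of a wire cancels, so each consistent assignment of the bits
    contributes the original probability.  Since the network is acyclic, the total
    weight of the consistent assignments is 1. *)
From HB Require Import structures.
From mathcomp Require Import all_boot all_order all_algebra.
From mathcomp Require Import complex.
From mathcomp Require Import boolp classical_sets reals fintype finset.
From mathcomp Require Import ring.
Require Import Defs.

Set Implicit Arguments.
Unset Strict Implicit.
Unset Printing Implicit Defensive.

Import Order.TTheory GRing.Theory Num.Theory.
Local Open Scope ring_scope.
Local Open Scope sesquilinear_scope.

(** * Positive matrices and completely positive maps *)

Lemma mul_trmxC (C : numClosedFieldType) m n p (A : 'M[C]_(m, n)) (B : 'M_(n, p)) :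
  (A *m B)^t* = B^t* *m A^t*.
Proof. by rewrite trmx_mul map_mxM. Qed.

Lemma hermsymmxE (C : numClosedFieldType) n (A : 'M[C]_n) :
  (A \is hermsymmx) = (A^t* == A).
Proof. by rewrite is_hermitianmxE expr0 scale1r eq_sym. Qed.

Section PSD.
Variable R : realType.
Local Notation C := R[i].

Lemma psd0 n : psd (0 : 'M[C]_n).
Proof.
split; first by rewrite hermsymmxE trmx0 map_mx0.
by move=> v; rewrite mulmx0 mul0mx mxE.
Qed.

Lemma psdD n (A B : 'M[C]_n) : psd A -> psd B -> psd (A + B).
Proof.
rewrite /psd !hermsymmxE => -[/eqP hA pA] [/eqP hB pB]; split.
  by rewrite linearD map_mxD hA hB.
by move=> v; rewrite mulmxDr mulmxDl mxE addr_ge0.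
Qed.

Lemma psdZ n (c : C) (A : 'M[C]_n) : 0 <= c -> psd A -> psd (c *: A).
Proof.
move=> c0; rewrite /psd !hermsymmxE => -[/eqP hA pA]; split.
  by rewrite linearZ map_mxZ hA /= (conj_Creal (ger0_real c0)).
by move=> v; rewrite -scalemxAr -scalemxAl mxE mulr_ge0.
Qed.

Lemma psd_sum n (I : finType) (P : pred I) (A : I -> 'M[C]_n) :
  (forall i, P i -> psd (A i)) -> psd (\sum_(i | P i) A i).
Proof. by move=> pA; apply: (big_ind (@psd R n)); [exact: psd0|exact: psdD|exact: pA]. Qed.

Lemma psd_sandwich m n (B : 'M[C]_(m, n)) (A : 'M[C]_n) :
  psd A -> psd (B *m A *m B^t*).
Proof.
rewrite /psd !hermsymmxE => -[/eqP hA pA]; split.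
  by rewrite !mul_trmxC trmxCK hA mulmxA.
move=> v; have := pA (B^t* *m v).
by rewrite mul_trmxC trmxCK !mulmxA.
Qed.

Lemma psd_tr_ge0 n (A : 'M[C]_n) : psd A -> 0 <= \tr A.
Proof.
move=> [_ pA]; apply: sumr_ge0 => i _.
have := pA (delta_mx i 0).
rewrite trmx_delta map_delta_mx -rowE -colE.
by rewrite !mxE.
Qed.

Lemma psd_trmxC n (A : 'M[C]_n) : psd A -> A^t* = A.
Proof. by case; rewrite hermsymmxE => /eqP. Qed.

Lemma psd_conj n (A : 'M[C]_n) : psd A -> psd (map_mx Num.conj A).
Proof.
rewrite /psd !hermsymmxE => -[/eqP hA pA]; split.
  by apply/eqP; rewrite -[in RHS]hA map_trmx.
move=> v; rewrite -conjC_ge0; have := pA (map_mx Num.conj v).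
suff -> : ((v^t* *m map_mx Num.conj A *m v) 0 0)^*%R =
   ((map_mx Num.conj v)^t* *m A *m map_mx Num.conj v) 0 0 by [].
transitivity (map_mx Num.conj (v^t* *m map_mx Num.conj A *m v) 0 0).
  by rewrite [RHS]mxE.
by rewrite !map_mxM -!map_mx_comp; congr ((_ *m _ *m _) 0 0);
  apply/matrixP => i j; rewrite !mxE /= ?conjCK.
Qed.

Lemma cp_sandwich m n p q (Lam : 'M[C]_m -> 'M[C]_n)
    (A : 'M[C]_(m, p)) (B : 'M[C]_(q, n)) :
  completely_positive Lam ->
  completely_positive (fun X => B *m Lam (A *m X *m A^t*) *m B^t*).
Proof.
(* Sandwiching every block by [D] is sandwiching the block matrix by the block-diagonal matrix with
   copies of [D]. *)
have sw (k r s : nat) (D : 'M[C]_(r, s)) (X : 'I_k -> 'I_k -> 'M[C]_s) :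
    let DD := \mxblock_(a < k, b < k) (if a == b then D else 0) in
    \mxblock_(a, b) (D *m X a b *m D^t*) = DD *m \mxblock_(a, b) X a b *m DD^t*.
  move=> DD; rewrite /DD tr_mxblock.
  have -> : map_mx Num.conj (\mxblock_(a < k, b < k) (if b == a then D else 0)^T) =
      \mxblock_(a < k, b < k) (if a == b then D^t* else 0).
    apply/matrixP => i j; rewrite !mxE eq_sym.
    by case: ifP => _; rewrite !mxE ?conjC0.
  rewrite !mul_mxblock; apply/eq_mxblock => a b.
  rewrite (bigD1 b) //= eqxx.
  rewrite [X in _ + X]big1 ?addr0 => [|c /negPf ->]; last by rewrite mulmx0.
  rewrite (bigD1 a) //= eqxx big1 ?addr0 // => c; rewrite eq_sym => /negPf ->.
  by rewrite mul0mx.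
move=> cpL k X pX; rewrite sw; apply: psd_sandwich; apply: cpL.
by rewrite sw; apply: psd_sandwich.
Qed.

Lemma cpZ m n (c : C) (Lam : 'M[C]_m -> 'M[C]_n) : 0 <= c ->
  completely_positive Lam -> completely_positive (fun X => c *: Lam X).
Proof.
move=> c0 cpL k X /cpL; move/(psdZ c0).
suff -> : \mxblock_(a, b) (c *: Lam (X a b)) = c *: \mxblock_(a, b) Lam (X a b) by [].
by apply/matrixP => i j; rewrite !mxE.
Qed.

Lemma cp_sum m n (I : finType) (Lam : I -> 'M[C]_m -> 'M[C]_n) :
  (forall i, completely_positive (Lam i)) ->
  completely_positive (fun X => \sum_i Lam i X).
Proof.
by move=> cpL k X pX; rewrite mxblock_sum; apply: psd_sum => i _; apply: cpL.
Qed.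

Lemma cp_positive m n (Lam : 'M[C]_m -> 'M[C]_n) (X : 'M[C]_m) :
  completely_positive Lam -> psd X -> psd (Lam X).
Proof.
move=> cpL pX.
(* Positivity is the case of a single block; a block matrix with one block is that block up to a
   cast of its dimension. *)
have sub1 (r : nat) (Y : 'M[C]_r) : psd (\mxblock_(a < 1, b < 1) Y) <-> psd Y.
  rewrite [Y in X in _ <-> X]mxEmxblock; move: (\mxblock_(a < 1, b < 1) Y) => Z.
  have cast p q (e e' : p = q) (D : 'M[C]_p) : psd D <-> psd (castmx (e, e') D).
    by case: _ / e e' => e'; rewrite castmx_id.
  exact: cast.
by apply/sub1/(cpL 1%N (fun _ _ => X))/sub1.
Qed.

(* The Choi matrix of Lam is positive, hence Hermitian. *)
Lemma cp_trmxC m n (Lam : 'M[C]_m -> 'M[C]_n) (X : 'M[C]_m) :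
  linear Lam -> completely_positive Lam -> Lam (X^t*) = (Lam X)^t*.
Proof.
move=> lL cpL.
pose L : {linear _ -> _} := HB.pack Lam (GRing.isLinear.Build _ _ _ _ Lam lL).
(* This is the unnormalised maximally entangled projector, of rank one on the sum of the vectors e_a
   (x) e_a. *)
have choi : psd (\mxblock_(a < m, b < m) (delta_mx a b : 'M[C]_m)).
  have -> : \mxblock_(a < m, b < m) (delta_mx a b : 'M[C]_m) =
      (\mxcol_(a < m) (delta_mx a 0 : 'cV[C]_m)) *m 1%:M *m
      (\mxcol_(a < m) (delta_mx a 0 : 'cV[C]_m))^t*.
    rewrite mulmx1 tr_mxcol.
    have -> : map_mx Num.conj (\mxrow_(a < m) (delta_mx a 0 : 'cV[C]_m)^T) =
       \mxrow_(a < m) (delta_mx 0 a : 'rV[C]_m).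
      apply/matrixP => i j; rewrite !mxE andbC.
      by case: (_ && _); rewrite ?conjC0 ?conjC1.
    by rewrite mul_mxcol_mxrow; under [RHS]eq_mxblock do rewrite mul_delta_mx.
  apply: psd_sandwich; split; first by rewrite hermsymmxE tr_scalar_mx map_mx1.
  move=> v; rewrite mulmx1 mxE; apply: sumr_ge0 => i _.
  by rewrite !mxE mulrC mul_conjC_ge0.
have hd a b : Lam (delta_mx b a) = (Lam (delta_mx a b))^t*.
  have := psd_trmxC (cpL m _ choi).
  rewrite tr_mxblock.
  have -> : map_mx Num.conj (\mxblock_(i < m, j < m) (Lam (delta_mx j i))^T) =
      \mxblock_(i < m, j < m) ((Lam (delta_mx j i))^t*).
    by apply/matrixP => i j; rewrite !mxE.
  by move/eq_mxblockP => /(_ b a) <-.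
have expand Y : Lam Y = \sum_i \sum_j Y i j *: Lam (delta_mx i j).
  rewrite {1}[Y]matrix_sum_delta -[LHS]/(L _) linear_sum; apply: eq_bigr => i _.
  by rewrite linear_sum; apply: eq_bigr => j _; rewrite linearZ.
rewrite [LHS]expand [in RHS]expand exchange_big raddf_sum raddf_sum.
apply: eq_bigr => i _; rewrite raddf_sum raddf_sum.
apply: eq_bigr => j _; rewrite hd; apply/matrixP => p q.
by rewrite !mxE /= rmorphM.
Qed.
End PSD.

(** * The frame isometry of one wire *)

(** Dependent choices are turned by [big_fprod] into functions to the tagged union, where
    [bigA_distr_big_dep] applies. *)
Lemma dffun_distr (C : comNzRingType) (I : finType) (T : I -> finType)
    (F : forall i, T i -> C) :
  \prod_i \sum_t F i t = \sum_(f : fam T) \prod_i F i (f i).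
Proof.
transitivity (\sum_(t : fprod T) \prod_i [ffun x => F i x] (t i)).
  rewrite (@big_fprod _ _ 1 _ _ _ _ (fun i => [ffun x => F i x])).
  under eq_bigr => i _.
    under eq_bigr => t _ do rewrite -[F i t](ffunE (F i)).
    rewrite (big_tag (fun i => [ffun x => F i x])); over.
  by rewrite bigA_distr_big_dep.
rewrite (reindex _ (onW_bij _ (fprod_of_dffun_bij T))); apply: eq_bigr => f _.
by apply: eq_bigr => i _; rewrite fprodE ffunE.
Qed.

(* Entry (a, i) of v |-> v (x) |+i>; the first n row indices carry the component on
   |0>, the last n the one on |1>. *)
Definition frame1 (C : numClosedFieldType) n (a : 'I_(n + n)) (i : 'I_n) : C :=
  (sqrtC 2)^-1 *
  match split a with inl j => (j == i)%:R | inr j => 'i * (j == i)%:R end.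

Section Frame1.
Variables (C : numClosedFieldType) (n : nat).
Local Notation J := (@frame1 C n).

Lemma frame1_lshift j i : J (lshift n j) i = (sqrtC 2)^-1 * (j == i)%:R.
Proof. by rewrite /frame1 (unsplitK (inl j)). Qed.

Lemma frame1_rshift j i : J (rshift n j) i = (sqrtC 2)^-1 * ('i * (j == i)%:R).
Proof. by rewrite /frame1 (unsplitK (inr j)). Qed.

Let s2 : (sqrtC 2 : C)^-1 * (sqrtC 2)^-1 = 2^-1.
Proof. by rewrite -invfM -expr2 sqrtCK. Qed.

Let i2 : 'i * 'i = -1 :> C.
Proof. by rewrite -expr2 sqrCi. Qed.

Let half : 2^-1 + 2^-1 = 1 :> C.
Proof. by rewrite [RHS]splitr mul1r. Qed.

Let mul_s2 (x y : C) : (sqrtC 2)^-1 * x * ((sqrtC 2)^-1 * y) = 2^-1 * (x * y).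
Proof. by rewrite mulrACA s2. Qed.

Let conj_s2 : ((sqrtC 2 : C)^-1)^* = (sqrtC 2)^-1.
Proof. by rewrite conj_Creal // realV ger0_real // sqrtC_ge0 ler0n. Qed.

Let frame1_conj (a : 'I_(n + n)) i : (J a i)^* = (sqrtC 2)^-1 *
  match split a with inl j => (j == i)%:R | inr j => - 'i * (j == i)%:R end.
Proof.
rewrite /frame1 rmorphM /= conj_s2; case: split => j; first by rewrite conjC_nat.
by rewrite rmorphM /= conjCi conjC_nat.
Qed.

Let delta (i j : 'I_n) : \sum_k (k == i)%:R * (k == j)%:R = (i == j)%:R :> C.
Proof.
rewrite (bigD1 i) //= eqxx mul1r big1 ?addr0 // => k /negPf ->.
by rewrite mul0r.
Qed.

Lemma frame1_iso i j : \sum_a (J a i)^* * J a j = (i == j)%:R.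
Proof.
rewrite big_split_ord /= -[RHS]mul1r -[X in _ = X * _]half mulrDl.
rewrite -delta !mulr_sumr; congr (_ + _); apply: eq_bigr => k _.
  by rewrite frame1_conj frame1_lshift (unsplitK (inl k)) mulrACA s2.
rewrite frame1_conj frame1_rshift (unsplitK (inr k)) mulrACA s2.
by rewrite [X in _ * X]mulrACA mulNr i2 opprK mul1r.
Qed.

(** The product is bilinear, without conjugation, so this is orthogonality of the ranges of the
    isometry and its conjugate; the two qubit components cancel as 1 + 'i ^ 2 = 0. *)
Lemma frame1_isotropic i j : \sum_a J a i * J a j = 0.
Proof.
rewrite big_split_ord /= -big_split /= big1 // => k _.
rewrite !frame1_lshift !frame1_rshift mulrACA [X in _ + X]mulrACA.
by rewrite [X in _ + _ * X]mulrACA i2 mulN1r mulrN subrr.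
Qed.

(** The second sum is the transposed range projection, that is, the projection onto the range of the
    conjugate isometry. On the qubit, the projections on |+i> and |-i> sum to the identity. *)
Lemma frame1_resolution a b :
  \sum_i J a i * (J b i)^* + \sum_i J b i * (J a i)^* = (a == b)%:R.
Proof.
have sum_delta (i j : 'I_n) : \sum_k (i == k)%:R * (j == k)%:R = (i == j)%:R :> C.
  by rewrite eq_sym -delta; apply: eq_bigr => k _; rewrite eq_sym [j == k]eq_sym mulrC.
rewrite -big_split /= -[a](splitK) -[b](splitK) (inj_eq (can_inj unsplitK)).
case: (split a) (split b) => i [] j /=.
- rewrite -[RHS]sum_delta; apply: eq_bigr => k _.
  rewrite !frame1_conj !frame1_lshift !(unsplitK (inl _)) !mul_s2.
  by rewrite [(j == k)%:R * _]mulrC -mulrDl half mul1r.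
- rewrite big1 // => k _.
  rewrite !frame1_conj !frame1_lshift !frame1_rshift (unsplitK (inl _)) (unsplitK (inr _)).
  by rewrite !mul_s2; ring.
- rewrite big1 // => k _.
  rewrite !frame1_conj !frame1_lshift !frame1_rshift (unsplitK (inl _)) (unsplitK (inr _)).
  by rewrite !mul_s2; ring.
- rewrite -[RHS]sum_delta; apply: eq_bigr => k _.
  rewrite !frame1_conj !frame1_rshift !(unsplitK (inr _)) !mul_s2.
  rewrite ![(_ * _) * (- _ * _)]mulrACA mulrN i2 opprK !mul1r.
  by rewrite [(j == k)%:R * _]mulrC -mulrDl half mul1r.
Qed.
End Frame1.

(** * Sums over product indices and over random bits *)

Lemma sum_enum_rank (V : nmodType) (T : finType) (F : 'I_#|T| -> V) :
  \sum_i F i = \sum_t F (enum_rank t).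
Proof. by rewrite (reindex _ (onW_bij _ (@enum_rank_bij T))). Qed.

Lemma prod_delta (C : comNzRingType) (I : finType) (T : I -> finType) (f g : fam T) :
  \prod_i (f i == g i)%:R = (f == g)%:R :> C.
Proof.
have [->|/eqP ne] := eqVneq f g; first by apply: big1 => i _; rewrite eqxx.
have [i nfg] : exists i, f i != g i.
  apply/existsP; apply: contra_notT ne; rewrite negb_exists => /forallP h.
  by apply/ffunP => i; apply/eqP/negPn/h.
by rewrite (bigD1 i) //= (negPf nfg) mul0r.
Qed.

(* Frame bits are variables indexed by Z, and phi : {set Z} is the set of those equal
   to 1.  A node reads the bits [key i] of its incoming wires [i] and draws each of
   the other bits uniformly. *)
Definition frame_wt (C : fieldType) (I Z : finType) (key : I -> Z) : C :=
  \prod_(z | z \notin codom key) 2^-1.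

(** The sum factorises over the bits: a bit that is read contributes both of its values unweighted,
    and any other bit contributes 1/2 + 1/2. *)
Lemma sum_frame_wt (C : numFieldType) (I Z : finType) (key : I -> Z)
    (g : I -> bool -> C) : injective key ->
  \sum_(phi : {set Z}) frame_wt C key * \prod_i g i (key i \in phi) =
  \prod_i (g i true + g i false).
Proof.
move=> key_inj.
(* [F b z] is the factor contributed by the bit [z] when it has the value [b]. *)
pose F b z : C := (if z \notin codom key then 2^-1 else 1) *
  \prod_(i | key i == z) g i b.
transitivity (\prod_z (F true z + F false z)).
  rewrite bigA_distr; apply: eq_bigr => phi _.
  rewrite (partition_big key predT) //= /frame_wt big_mkcond -big_split /=.
  apply: eq_bigr => z _; rewrite /F.
  case: (boolP (z \in phi)) => zphi; congr (_ * _);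
    by apply: eq_bigr => i /eqP ->; rewrite ?zphi ?(negPf zphi).
rewrite [RHS](partition_big key predT) //=; apply: eq_bigr => z _; rewrite /F.
case: ifP => [zk|/negbFE/codomP[i ->]].
  have no i : key i == z = false by apply: contraNF zk => /eqP <-; exact: codom_f.
  by rewrite !big_pred0 // !mulr1 [RHS]splitr mul1r.
by rewrite !(big_pred1 i) ?mul1r // => j; apply: inj_eq.
Qed.

(** * Partial transposition and framed operators *)

Definition symdiff (W : finType) (S U : {set W}) : {set W} :=
  [set w | (w \in S) (+) (w \in U)].

Section PTrans.
Variables (R : realType) (W : finType) (d : W -> nat) (D : {set W}).
Local Notation C := R[i].
Implicit Types (A B : op R d D) (S U : {set W}) (k l : idx d D).

Lemma entryP A B : (forall k l, entry A k l = entry B k l) -> A = B.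
Proof.
move=> eAB; apply/matrixP => i j.
by have := eAB (enum_val i) (enum_val j); rewrite /entry !enum_valK.
Qed.

Lemma entry_opmx (f : idx d D -> idx d D -> C) k l : entry (opmx f) k l = f k l.
Proof. by rewrite /entry mxE !enum_rankK. Qed.

Lemma entry_ptrans S A k l :
  entry (ptrans S A) k l = entry A (mix S k l) (mix S l k).
Proof. exact: entry_opmx. Qed.

Lemma entryD A B k l : entry (A + B) k l = entry A k l + entry B k l.
Proof. exact: mxE. Qed.

Lemma entryZ (c : C) A k l : entry (c *: A) k l = c * entry A k l.
Proof. exact: mxE. Qed.

Lemma entry_sum (I : finType) (P : pred I) (A : I -> op R d D) k l :
  entry (\sum_(i | P i) A i) k l = \sum_(i | P i) entry (A i) k l.
Proof. exact: summxE. Qed.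

Lemma entry1 k l : entry (1%:M : op R d D) k l = (k == l)%:R.
Proof. by rewrite /entry mxE (inj_eq enum_rank_inj). Qed.

Lemma entry_trmxC A k l : entry (A^t*) k l = (entry A l k)^*%R.
Proof. by rewrite /entry !mxE. Qed.

Lemma entry_conj A k l : entry (map_mx Num.conj A) k l = (entry A k l)^*%R.
Proof. by rewrite /entry !mxE. Qed.

Lemma entry_matunit k0 l0 k l :
  entry (matunit R k0 l0) k l = (k == k0)%:R * (l == l0)%:R.
Proof. by rewrite /entry mxE !(inj_eq enum_rank_inj) -natrM mulnb. Qed.

Lemma op_sum_matunit A : A = \sum_k \sum_l entry A k l *: matunit R k l.
Proof.
by rewrite {1}[A]matrix_sum_delta sum_enum_rank; apply: eq_bigr => k _;
  rewrite sum_enum_rank.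
Qed.

Lemma mixE S k l w : mix S k l w = if val w \in S then l w else k w.
Proof. by rewrite ffunE. Qed.

Lemma mixK S k l : mix S (mix S k l) (mix S l k) = k.
Proof. by apply/ffunP => w; rewrite !mixE; case: ifP => // ->. Qed.

Lemma sum_mix S (F : idx d D -> idx d D -> C) :
  \sum_k \sum_l F k l = \sum_k \sum_l F (mix S k l) (mix S l k).
Proof.
rewrite !pair_big (reindex (fun p => (mix S p.1 p.2, mix S p.2 p.1))) //=.
apply/onW_bij; exists (fun p => (mix S p.1 p.2, mix S p.2 p.1));
by move=> [k l]; rewrite /= !mixK.
Qed.

Lemma ptrans_symdiff S U A : ptrans S (ptrans U A) = ptrans (symdiff U S) A.
Proof.
apply: entryP => k l; rewrite !entry_ptrans.
congr (entry A _ _); apply/ffunP => w; rewrite !mixE inE;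
by case: (_ \in S); case: (_ \in U).
Qed.

Lemma ptrans_eqD S U A : {in D, forall w, (w \in S) = (w \in U)} ->
  ptrans S A = ptrans U A.
Proof.
move=> eSU; apply: entryP => k l; rewrite !entry_ptrans.
by congr (entry A _ _); apply/ffunP => w; rewrite !mixE eSU // (valP w).
Qed.

Lemma ptrans0 A : ptrans finset.set0 A = A.
Proof.
apply: entryP => k l; rewrite !entry_ptrans.
by congr (entry A _ _); apply/ffunP => w; rewrite !mixE inE.
Qed.

Lemma ptrans_is_linear S : linear (@ptrans R W d D S).
Proof.
by move=> c A B; apply: entryP => k l;
  rewrite entryD entryZ !entry_ptrans entryD entryZ.
Qed.
HB.instance Definition _ S := GRing.isLinear.Build C _ _ _ _ (ptrans_is_linear S).

Lemma ptransZ S (c : C) A : ptrans S (c *: A) = c *: ptrans S A.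
Proof. by apply: entryP => k l; rewrite entryZ !entry_ptrans entryZ. Qed.

Lemma ptrans1 S : ptrans S 1%:M = 1%:M :> op R d D.
Proof.
apply: entryP => k l; rewrite entry_ptrans !entry1; congr (_%:R); congr nat_of_bool.
apply/eqP/eqP => [/ffunP e|->//]; apply/ffunP => w.
by have := e w; rewrite !mixE; case: ifP.
Qed.

Lemma trmxC_ptrans S A : (ptrans S A)^t* = ptrans S (A^t*).
Proof. by apply: entryP => k l; rewrite !(entry_trmxC, entry_ptrans). Qed.

(** Conjugation thus acts on Hermitian operators as a partial transposition, which flipping all
    frame bits can compensate. *)
Lemma conj_op A : map_mx Num.conj A = ptrans [set: W] (A^t*).
Proof.
apply: entryP => k l; rewrite entry_ptrans entry_trmxC entry_conj.
congr ((entry A _ _)^*)%R; apply/ffunP => w; by rewrite mixE inE.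
Qed.

Lemma ptrans_matunit S k l :
  ptrans S (matunit R k l) = matunit R (mix S k l) (mix S l k).
Proof.
apply: entryP => k' l'; rewrite entry_ptrans !entry_matunit -!natrM !mulnb.
congr (_%:R); congr nat_of_bool.
by apply/andP/andP => -[/eqP e1 /eqP e2]; rewrite -?e1 -?e2 ?mixK ?e1 ?e2 ?mixK !eqxx.
Qed.

Lemma tr_op A : \tr A = \sum_k entry A k k.
Proof. exact: sum_enum_rank. Qed.

Lemma tr_mul_op A B : \tr (A *m B) = \sum_k \sum_l entry A k l * entry B l k.
Proof.
rewrite tr_op; apply: eq_bigr => k _.
by rewrite /entry mxE sum_enum_rank.
Qed.

Lemma tr_mul_ptrans S A B : \tr (A *m ptrans S B) = \tr (ptrans S A *m B).
Proof.
rewrite !tr_mul_op (sum_mix S); apply: eq_bigr => k _; apply: eq_bigr => l _.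
by rewrite !entry_ptrans !mixK.
Qed.

Lemma tr_ptrans S A : \tr (ptrans S A) = \tr A.
Proof.
rewrite !tr_op; apply: eq_bigr => k _; rewrite entry_ptrans.
by congr entry; apply/ffunP => w; rewrite mixE; case: ifP.
Qed.

End PTrans.

Section Frame.
Variables (R : realType) (W : finType) (d : W -> nat) (D : {set W}).
Local Notation C := R[i].
Local Notation dd := (fun w => d w + d w)%N.
Implicit Types (A : op R d D) (X : op R dd D) (S U : {set W}).
Implicit Types (k l : idx d D) (p q : idx dd D).

(* The isometry J_S: the wires in S carry the conjugate isometry. *)
Definition frame S p k : C :=
  \prod_(i : {w | w \in D})
     (if val i \in S then (frame1 C (p i) (k i))^*%R else frame1 C (p i) (k i)).

Definition framemx S : 'M[C]_(#|idx dd D|, #|idx d D|) :=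
  \matrix_(i, j) frame S (enum_val i) (enum_val j).

Definition emb S A : op R dd D := framemx S *m A *m (framemx S)^t*.
Definition unemb S X : op R d D := (framemx S)^t* *m X *m framemx S.

Lemma entry_emb S A p q : entry (emb S A) p q =
  \sum_k \sum_l frame S p k * entry A k l * (frame S q l)^*%R.
Proof.
rewrite /entry !mxE sum_enum_rank exchange_big; apply: eq_bigr => l _.
rewrite !mxE sum_enum_rank mulr_suml; apply: eq_bigr => k _.
by rewrite !mxE !enum_rankK.
Qed.

Lemma entry_unemb S X k l : entry (unemb S X) k l =
  \sum_p \sum_q (frame S p k)^*%R * entry X p q * frame S q l.
Proof.
rewrite /entry !mxE sum_enum_rank exchange_big; apply: eq_bigr => q _.
rewrite !mxE sum_enum_rank mulr_suml; apply: eq_bigr => p _.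
by rewrite !mxE !enum_rankK.
Qed.

(** On a wire of [S], exchanging row and column indices conjugates the two isometry factors, so the
    wire enters or leaves the set of conjugated wires. *)
Lemma frame_mix S U p q k l :
  frame U (mix S p q) (mix S k l) * (frame U (mix S q p) (mix S l k))^*%R =
  frame (symdiff U S) p k * (frame (symdiff U S) q l)^*%R.
Proof.
rewrite /frame !rmorph_prod -!big_split; apply: eq_bigr => w _ /=.
rewrite !mixE inE; case: (_ \in S); case: (_ \in U) => //=;
by rewrite ?conjCK mulrC.
Qed.

Lemma ptrans_emb S U A :
  ptrans S (emb U A) = emb (symdiff U S) (ptrans S A).
Proof.
apply: entryP => p q; rewrite entry_ptrans !entry_emb (sum_mix S).
apply: eq_bigr => k _; apply: eq_bigr => l _.
by rewrite mulrAC frame_mix entry_ptrans mulrAC.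
Qed.

Lemma ptrans_unemb S U X :
  ptrans S (unemb U X) = unemb (symdiff U S) (ptrans S X).
Proof.
apply: entryP => k l; rewrite entry_ptrans !entry_unemb (sum_mix S).
apply: eq_bigr => p _; apply: eq_bigr => q _.
rewrite [LHS]mulrAC [X in X * _ = _]mulrC frame_mix entry_ptrans.
by rewrite [RHS]mulrC mulrA.
Qed.

Lemma framemx_iso S : (framemx S)^t* *m framemx S = 1%:M.
Proof.
apply: entryP => k l; rewrite entry1 /entry mxE sum_enum_rank.
under eq_bigr => p _ do rewrite !mxE !enum_rankK /frame rmorph_prod -big_split /=.
rewrite -(dffun_distr (fun w a =>
  (if val w \in S then (frame1 C a (k w))^* else frame1 C a (k w))^* *
  (if val w \in S then (frame1 C a (l w))^* else frame1 C a (l w)))%R).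
rewrite -prod_delta; apply: eq_bigr => w _; case: (val w \in S); last exact: frame1_iso.
under eq_bigr => a _ do rewrite conjCK [_ * _]mulrC.
by rewrite frame1_iso eq_sym.
Qed.

Lemma tr_emb S A : \tr (emb S A) = \tr A.
Proof. by rewrite /emb mxtrace_mulC !mulmxA framemx_iso mul1mx. Qed.

Lemma emb_is_linear S : linear (@emb S).
Proof.
by move=> c A B; rewrite /emb mulmxDr mulmxDl -scalemxAr -scalemxAl.
Qed.
HB.instance Definition _ S := GRing.isLinear.Build C _ _ _ _ (emb_is_linear S).

Lemma unemb_is_linear S : linear (@unemb S).
Proof.
by move=> c A B; rewrite /unemb mulmxDr mulmxDl -scalemxAr -scalemxAl.
Qed.
HB.instance Definition _ S := GRing.isLinear.Build C _ _ _ _ (unemb_is_linear S).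

Lemma trmxC_emb S A : (emb S A)^t* = emb S (A^t*).
Proof. by rewrite /emb !mul_trmxC trmxCK mulmxA. Qed.

Lemma trmxC_unemb S X : (unemb S X)^t* = unemb S (X^t*).
Proof. by rewrite /unemb !mul_trmxC trmxCK mulmxA. Qed.

Lemma psd_emb S A : psd A -> psd (emb S A).
Proof. exact: psd_sandwich. Qed.

(** Wires with distinct keys have independent bits, so the sum factorises into the one-wire identity
    [frame1_resolution]; the bits not read average out. *)
Lemma resolution (Z : finType) (key : W -> Z) : {in D &, injective key} ->
  \sum_(phi : {set Z}) frame_wt C (fun i : {w | w \in D} => key (val i)) *:
    ptrans (key @^-1: phi) (emb finset.set0 1%:M) = 1%:M.
Proof.
move=> key_inj; apply: entryP => p q; rewrite entry_sum entry1.
(* [g w b] is an entry of the range projection on the wire [w], transposed exactly when the bit [b]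
   is 1. *)
pose g (w : {w | w \in D}) (b : bool) : C :=
  \sum_i frame1 C (if b then q w else p w) i *
         (frame1 C (if b then p w else q w) i)^*%R.
transitivity (\sum_(phi : {set Z})
    frame_wt C (fun i : {w | w \in D} => key (val i)) *
    \prod_w g w (key (val w) \in phi)).
  apply: eq_bigr => phi _; rewrite entryZ entry_ptrans entry_emb; congr (_ * _).
  rewrite /g (dffun_distr (fun (w : {w | w \in D}) i =>
    frame1 C (if key (val w) \in phi then q w else p w) i *
    (frame1 C (if key (val w) \in phi then p w else q w) i)^*%R)).
  apply: eq_bigr => k _.
  under [LHS]eq_bigr => l _ do rewrite entry1 mulrAC mulr_natr mulrb eq_sym.
  rewrite -big_mkcond big_pred1_eq /frame rmorph_prod -big_split /=.
  by apply: eq_bigr => w _; rewrite !mixE !inE.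
rewrite sum_frame_wt; last by move=> i j /(key_inj _ _ (valP i) (valP j)) /val_inj.
rewrite -prod_delta; apply: eq_bigr => w _.
by rewrite addrC frame1_resolution.
Qed.

End Frame.

(** * Real states, effects and instruments *)

Lemma completely_PPT_cp (R : realType) (W L : finType) (d : W -> nat) (lab : W -> L)
    (Din D : {set W}) (Lam : op R d Din -> op R d D) :
  completely_PPT lab Lam -> completely_positive Lam.
Proof.
move=> [_ /(_ finset.set0)]; congr completely_positive; apply/funext => X.
rewrite /gamma_conj; have -> : [set w | lab w \in finset.set0] = finset.set0.
  by apply/setP => w; rewrite !inE.
by rewrite !ptrans0.
Qed.

Section FrameOp.
Variables (R : realType) (W Z : finType) (d : W -> nat) (key : W -> Z).
Local Notation C := R[i].
Local Notation dd := (fun w => d w + d w)%N.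

Local Notation wt Din := (frame_wt C (fun i : {w : W | w \in Din} => key (val i))).

Lemma frame_wt_ge0 (Din : {set W}) : 0 <= wt Din.
Proof. by apply: prodr_ge0 => z _; rewrite invr_ge0 ler0n. Qed.

Lemma conj_frame_wt (Din : {set W}) : (wt Din)^*%R = wt Din.
Proof. exact/conj_Creal/ger0_real/frame_wt_ge0. Qed.

(** Conjugation is the full transposition of the adjoint, so it carries the term of [phi] to the
    term of its complement and permutes the sum. *)
Lemma sum_ptrans_conj (I D : {set W}) (A : {set Z} -> op R dd D) :
  (forall phi, A (~: phi) = (A phi)^t*) ->
  map_mx Num.conj (\sum_(phi : {set Z}) wt I *: ptrans (key @^-1: phi) (A phi)) =
  \sum_(phi : {set Z}) wt I *: ptrans (key @^-1: phi) (A phi).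
Proof.
move=> hA; rewrite raddf_sum (reindex_inj (inv_inj (@setCK Z))).
apply: eq_bigr => phi _; rewrite /= map_mxZ.
congr (_ *: _); first exact: conj_frame_wt.
rewrite conj_op trmxC_ptrans ptrans_symdiff hA trmxCK.
by congr ptrans; apply/setP => w; rewrite !inE; case: (_ \in _).
Qed.

(** [Din] holds the wires whose bits are read: it is empty for a state, which draws all bits, and
    equal to [D] for an effect. *)
Definition frame_op (Din D : {set W}) (A : op R d D) : op R dd D :=
  \sum_(phi : {set Z}) wt Din *: ptrans (key @^-1: phi) (emb finset.set0 A).

(** Decoding and encoding use the same [phi], so an input and an output wire with the same key share
    their bit. This matches the joint transposition of both ends of a label in [completely_PPT]. *)
Definition frame_map (Din D : {set W}) (Lam : op R d Din -> op R d D)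
    (X : op R dd Din) : op R dd D :=
  \sum_(phi : {set Z}) wt Din *:
    ptrans (key @^-1: phi)
      (emb finset.set0 (Lam (unemb finset.set0 (ptrans (key @^-1: phi) X)))).

Lemma realmx_conj n (A : 'M[C]_n) : map_mx Num.conj A = A -> A \is a realmx.
Proof. by move=> e; apply/mxOverP => i j; apply/CrealP; rewrite -[in RHS]e mxE. Qed.

(** In this form each term is an isometric image of a partial transpose of [A], so it inherits
    positivity from those. *)
Lemma ptrans_frame_op (Din D S : {set W}) (A : op R d D) :
  ptrans S (frame_op Din A) =
  \sum_(phi : {set Z}) wt Din *:
    emb (symdiff (key @^-1: phi) S) (ptrans (symdiff (key @^-1: phi) S) A).
Proof.
rewrite raddf_sum; apply: eq_bigr => phi _; rewrite /= ptransZ.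
rewrite ptrans_symdiff ptrans_emb; congr (_ *: emb _ _).
by apply/setP => w; rewrite !inE.
Qed.

Lemma frame_op_is_linear Din D : linear (@frame_op Din D).
Proof.
move=> c A B; rewrite /frame_op scaler_sumr -big_split; apply: eq_bigr => phi _.
rewrite (@emb_is_linear R W d) (@ptrans_is_linear R W dd).
by rewrite /= scalerDr !scalerA mulrC.
Qed.
HB.instance Definition _ Din D :=
  GRing.isLinear.Build C _ _ _ _ (@frame_op_is_linear Din D).

Lemma frame_op_real (Din D : {set W}) (A : op R d D) :
  A^t* = A -> frame_op Din A \is a realmx.
Proof.
move=> hA; apply: realmx_conj; apply: (@sum_ptrans_conj _ _ (fun=> _)) => _.
by rewrite trmxC_emb hA.
Qed.

Lemma frame_op_psd (Din D S : {set W}) (A : op R d D) :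
  (forall U, psd (ptrans U A)) -> psd (ptrans S (frame_op Din A)).
Proof.
move=> pA; rewrite ptrans_frame_op; apply: psd_sum => phi _.
by apply: psdZ; [exact: frame_wt_ge0|exact: psd_emb].
Qed.

Lemma frame_op1 (D : {set W}) : {in D &, injective key} ->
  frame_op D (1%:M : op R d D) = 1%:M.
Proof. exact: resolution. Qed.

Lemma frame_op_effect th (D : {set W}) (E : op R d D) :
  {in D &, injective key} -> is_effect th E -> is_effect sT (frame_op D E).
Proof.
move=> key_inj [hE pE _].
have p1 S : psd (ptrans S (frame_op D E)).
  by apply: frame_op_psd => U; case: (pE U).
split; last by apply: frame_op_real; apply/eqP; rewrite -hermsymmxE.
  by have := p1 finset.set0; rewrite ptrans0; case.
(* Since framing is linear and fixes the identity, the upper bound is the positivity statement for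
   the complementary effect. *)
move=> S; split=> //; rewrite -(ptrans1 R dd D S) -(frame_op1 key_inj).
rewrite -!raddfB; apply: frame_op_psd => U.
by rewrite raddfB /= ptrans1; case: (pE U).
Qed.

Lemma frame_op_measurement th (D : {set W}) (O : finType) (E : O -> op R d D) :
  {in D &, injective key} -> is_measurement th E ->
  is_measurement sT (fun o => frame_op D (E o)).
Proof.
move=> key_inj [eE sE]; split; first by move=> o; apply: frame_op_effect (eE o).
by rewrite -(frame_op1 key_inj) -sE raddf_sum.
Qed.

(** A state need not have positive partial transposes. With one key for all its wires, only the
    identity and the full transposition occur, and both preserve positivity. *)
Lemma frame_op_state th (D : {set W}) (z : Z) (rho : op R d D) :
  {in D, forall w, key w = z} -> is_state th rho ->
  is_state sT (frame_op finset.set0 rho).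
Proof.
move=> keyz [p1 t1 _].
split; last by apply: frame_op_real; exact: psd_trmxC.
  rewrite -[frame_op _ _]ptrans0 ptrans_frame_op; apply: psd_sum => phi _.
  apply: psdZ; [exact: frame_wt_ge0|apply: psd_emb].
  set S := symdiff _ _; suff : ptrans S rho = rho \/ ptrans S rho = map_mx Num.conj rho.
    by case=> ->; [|exact: psd_conj].
  rewrite conj_op psd_trmxC //.
  have SE : {in D, forall w, (w \in S) = (z \in phi)}.
    by move=> w wD; rewrite !inE keyz // addbF.
  case: (boolP (z \in phi)) => zphi; [right|left].
    by apply: ptrans_eqD => w wD; rewrite SE // inE.
  rewrite -[RHS]ptrans0; apply: ptrans_eqD => w wD.
  by rewrite SE // inE (negPf zphi).
rewrite raddf_sum /=.
under eq_bigr => phi _ do rewrite mxtraceZ tr_ptrans tr_emb t1.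
have no (i : {w : W | w \in finset.set0}) : False by case: i => w; rewrite inE.
have key_inj : injective (fun i : {w : W | w \in finset.set0} => key (val i)).
  by move=> i; case: (no i).
(* No bit is read, so the total weight is an empty product by [sum_frame_wt]. *)
transitivity (\prod_(i : {w : W | w \in finset.set0}) (1 + 1) : C); last first.
  by apply: big1 => i; case: (no i).
rewrite -(sum_frame_wt (fun _ _ => 1) key_inj).
by apply: eq_bigr => phi _; rewrite big1_eq.
Qed.

Lemma sum_frame_map (Din D : {set W}) (O : finType) (Lam : O -> op R d Din -> op R d D) X :
  \sum_o frame_map (Lam o) X = frame_map (fun Y => \sum_o Lam o Y) X.
Proof.
rewrite exchange_big; apply: eq_bigr => phi _.
by rewrite !raddf_sum.
Qed.

Lemma frame_map_is_linear (Din D : {set W}) (Lam : op R d Din -> op R d D) :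
  linear Lam -> linear (frame_map Lam).
Proof.
move=> lL c A B; rewrite /frame_map scaler_sumr -big_split; apply: eq_bigr => phi _.
rewrite (@ptrans_is_linear R W dd) (@unemb_is_linear R W d) lL.
rewrite (@emb_is_linear R W d) (@ptrans_is_linear R W dd).
by rewrite /= scalerDr !scalerA mulrC.
Qed.

(** Conjugation exchanges [phi] with its complement at input and output; in between, the adjoint
    passes through [Lam] by [cp_trmxC]. *)
Lemma frame_map_conj (Din D : {set W}) (Lam : op R d Din -> op R d D) :
  linear Lam -> completely_positive Lam -> commutes_with_conj (frame_map Lam).
Proof.
move=> lL cpL X; rewrite [RHS]raddf_sum (reindex_inj (@finset.setC_inj Z)).
apply: eq_bigr => phi _; rewrite /= map_mxZ.
have co : symdiff (key @^-1: (~: phi)) [set: W] = key @^-1: phi.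
  by apply/setP => w; rewrite !inE addbT negbK.
have co' : symdiff [set: W] (key @^-1: phi) = key @^-1: (~: phi).
  by apply/setP => w; rewrite !inE.
congr (_ *: _); first exact/esym/conj_frame_wt.
rewrite [X in _ = X]conj_op trmxC_ptrans ptrans_symdiff co trmxC_emb.
rewrite -(cp_trmxC _ lL cpL).
by rewrite trmxC_unemb trmxC_ptrans (conj_op X) ptrans_symdiff co'.
Qed.

(** The trace of each term tests [X] against a transposed range projection of the frame isometry,
    and these resolve the identity by [frame_op1]. *)
Lemma frame_map_trace (Din D : {set W}) (Lam : op R d Din -> op R d D) :
  {in Din &, injective key} -> trace_preserving Lam -> trace_preserving (frame_map Lam).
Proof.
move=> key_inj tL X; transitivity (\tr (frame_op Din 1%:M *m X)); last first.
  by rewrite frame_op1 ?mul1mx.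
rewrite /frame_op mulmx_suml [LHS]raddf_sum [RHS]raddf_sum /=.
apply: eq_bigr => phi _; rewrite -scalemxAl [LHS]mxtraceZ [RHS]mxtraceZ.
congr (_ * _); rewrite tr_ptrans tr_emb tL -tr_mul_ptrans.
by rewrite /unemb mxtrace_mulC mulmxA /emb mulmx1.
Qed.

(** Transposing the labels in [V] at both ends shifts the bit pattern by [V]. As keys depend only on
    labels, the wires then transposed are again given by a set of labels, and each term is a
    completely positive [gamma_conj] of [Lam] between fixed matrices. *)
Lemma frame_map_PPT (L : finType) (lab : W -> L) (inj : L -> Z)
    (Din D : {set W}) (Lam : op R d Din -> op R d D) :
  key =1 inj \o lab ->
  completely_PPT lab Lam -> completely_PPT lab (frame_map Lam).
Proof.
move=> keyE [lL cpL]; split; first exact: frame_map_is_linear.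
move=> V; pose V' (phi : {set Z}) := symdiff (inj @^-1: phi) V.
have -> : gamma_conj lab V (frame_map Lam) = fun X => \sum_(phi : {set Z})
    wt Din *: emb [set w | lab w \in V' phi]
      (gamma_conj lab (V' phi) Lam (unemb [set w | lab w \in V' phi] X)).
  apply/funext => X; rewrite /gamma_conj raddf_sum; apply: eq_bigr => phi _.
  have e : symdiff (key @^-1: phi) [set w | lab w \in V] = [set w | lab w \in V' phi].
    by apply/setP => w; rewrite !inE keyE.
  have e' : symdiff [set w | lab w \in V] (key @^-1: phi) = [set w | lab w \in V' phi].
    by apply/setP => w; rewrite !inE keyE addbC.
  have e0 U : symdiff finset.set0 U = U :> {set W} by apply/setP => w; rewrite !inE.
  have e1 U : symdiff U U = finset.set0 :> {set W}.
    by apply/setP => w; rewrite !inE addbb.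
  rewrite /= ptransZ; congr (_ *: _).
  rewrite ptrans_symdiff e ptrans_emb e0 ptrans_symdiff e'.
  by rewrite ptrans_unemb e1.
apply: cp_sum => phi; apply: cpZ; first exact: frame_wt_ge0.
have -> : (fun X => emb [set w | lab w \in V' phi]
      (gamma_conj lab (V' phi) Lam (unemb [set w | lab w \in V' phi] X))) =
   fun X => framemx R d D [set w | lab w \in V' phi] *m gamma_conj lab (V' phi) Lam
     ((framemx R d Din [set w | lab w \in V' phi])^t* *m X *m
      ((framemx R d Din [set w | lab w \in V' phi])^t*)^t*) *m
     (framemx R d D [set w | lab w \in V' phi])^t*.
  by apply/funext => X; rewrite trmxCK.
exact: cp_sandwich.
Qed.

Lemma frame_map_instrument th (L : finType) (lab : W -> L) (inj : L -> Z)
    (Din D : {set W}) (O : finType) (Lam : O -> op R d Din -> op R d D) :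
  key =1 inj \o lab -> {in Din &, injective key} ->
  is_instrument th lab Lam -> is_instrument sT lab (fun o => frame_map (Lam o)).
Proof.
move=> keyE key_inj [iL [[lS cpS] tS _]].
have sumE : (fun X => \sum_o frame_map (Lam o) X) = frame_map (fun Y => \sum_o Lam o Y).
  by apply/funext => X; exact: sum_frame_map.
have tp : trace_preserving (fun X => \sum_o frame_map (Lam o) X).
  by rewrite sumE; exact: frame_map_trace.
split; last first.
  split=> //; rewrite sumE; first exact: frame_map_PPT.
  by apply: frame_map_conj => //; apply: (@completely_PPT_cp _ _ _ _ lab).
move=> o; have [pptL _ _] := iL o; split.
- exact: frame_map_PPT.
- move=> X pX.
  (* Each element is positive and their sum preserves the trace. *)
  have -> : \tr X = \sum_o' \tr (frame_map (Lam o') X).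
    by rewrite -[LHS]tp raddf_sum.
  rewrite (bigD1 o) //= lerDl; apply: sumr_ge0 => o' _.
  apply: psd_tr_ge0; apply: cp_positive pX.
  apply: (@completely_PPT_cp _ _ _ _ lab); apply: frame_map_PPT keyE _.
  by case: (iL o').
- by case: (pptL) => lL _; apply: frame_map_conj => //; exact: completely_PPT_cp pptL.
Qed.

End FrameOp.

(** * Contraction of the network *)

(** Every wire has exactly one end under [t], so separate choices at all nodes amount to one global
    choice. *)
Lemma prod_sum_restr (C : comNzRingType) (V W : finType) (T : W -> finType) (t : W -> V)
    (F : forall u, subfam T [set w | t w == u] -> C) :
  \prod_u \sum_a F u a =
  \sum_(k : fam T) \prod_u F u (restr [set w | t w == u] k).
Proof.
have tP w : w \in [set w' | t w' == t w] by rewrite inE.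
rewrite (dffun_distr F).
rewrite (reindex (fun k : fam T => [ffun u => restr [set w | t w == u] k] :
  fam (fun u => subfam T [set w | t w == u]))) /=.
  by apply: eq_bigr => k _; apply: eq_bigr => u _; rewrite ffunE.
apply/onW_bij; exists (fun g : fam (fun u => subfam T [set w | t w == u]) =>
  [ffun w => g (t w) (exist _ w (tP w))] : fam T).
  by move=> k; apply/ffunP => w; rewrite !ffunE.
move=> g; apply/ffunP => u; apply/ffunP => -[w wu]; rewrite !ffunE /=.
have e : t w = u by move: wu; rewrite inE => /eqP.
by subst u; rewrite (bool_irrelevance (tP w) wu).
Qed.

Lemma prod_restr (C : comNzRingType) (V W : finType) (t : W -> V) (F : V -> W -> C) :
  \prod_u \prod_(i : {w | w \in [set w | t w == u]}) F u (val i) = \prod_w F (t w) w.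
Proof.
rewrite [RHS](partition_big t predT) //=; apply: eq_bigr => u _.
rewrite -(big_sub _ (F u)); apply: eq_big => [w|w]; rewrite inE //.
by move=> /eqP ->.
Qed.

Lemma exchange_big2 (C : nmodType) (I J K : finType) (F : I -> J -> K -> C) :
  \sum_i \sum_j \sum_k F i j k = \sum_k \sum_i \sum_j F i j k.
Proof.
by rewrite exchange_big /=; under eq_bigr do rewrite exchange_big /=;
  rewrite exchange_big; apply: eq_bigr => k _; rewrite exchange_big.
Qed.

(** The bits [st] and [sh] are those used at the tail and the head. If they agree, both sums are
    isometry relations; if not, a sum of the form [frame1_isotropic] factors out. *)
Lemma frame1_wire (C : numClosedFieldType) n (st sh : bool) (i j i' j' : 'I_n) :
  \sum_a \sum_b (frame1 C (if sh then b else a) i)^*%R * frame1 C (if sh then a else b) j *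
    frame1 C (if st then b else a) i' * (frame1 C (if st then a else b) j')^*%R =
  (st == sh)%:R * ((i == i')%:R * (j == j')%:R).
Proof.
case: st; case: sh => /=.
- rewrite exchange_big mul1r -frame1_iso [j == j']eq_sym -frame1_iso mulr_suml.
  apply: eq_bigr => a _; rewrite mulr_sumr; apply: eq_bigr => b _; ring.
- rewrite mul0r big1 // => a _.
  rewrite -[RHS](mulr0 ((frame1 C a i)^*%R * (frame1 C a j')^*%R)).
  rewrite -[X in _ = _ * X](frame1_isotropic C j i') mulr_sumr; apply: eq_bigr => b _; ring.
- rewrite mul0r exchange_big big1 // => b _.
  rewrite -[RHS](mulr0 ((frame1 C b i)^*%R * (frame1 C b j')^*%R)).
  rewrite -[X in _ = _ * X](frame1_isotropic C j i') mulr_sumr; apply: eq_bigr => a _; ring.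
- rewrite mul1r -frame1_iso [j == j']eq_sym -frame1_iso mulr_suml.
  apply: eq_bigr => a _; rewrite mulr_sumr; apply: eq_bigr => b _; ring.
Qed.

Section Contraction.
Variables (R : realType) (V W : finType) (d : W -> nat) (tl hd : W -> V).
Local Notation C := R[i].
Local Notation dd := (fun w => d w + d w)%N.
Local Notation inn u := [set w | hd w == u].
Local Notation out u := [set w | tl w == u].

(* The tensor of a node with incoming wires I and outgoing wires O, framed on both
   sides and transposed on S. *)
Definition emb_tensor (I O S : {set W})
    (N : idx d I -> idx d I -> idx d O -> idx d O -> C)
    (p q : idx dd I) (p' q' : idx dd O) : C :=
  \sum_k \sum_l \sum_k' \sum_l'
    (frame R finset.set0 (mix S p q) k)^*%R * frame R finset.set0 (mix S q p) l *
    frame R finset.set0 (mix S p' q') k' * (frame R finset.set0 (mix S q' p') l')^*%R *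
    N k l k' l'.

Lemma prod_frame (t : W -> V) (S : V -> {set W})
    (p q : fam (fun w => 'I_(dd w) : finType)) (k : fam (fun w => 'I_(d w) : finType)) :
  \prod_u frame R finset.set0 (mix (S u) (restr [set w | t w == u] p)
     (restr [set w | t w == u] q)) (restr [set w | t w == u] k) =
  \prod_w frame1 C (if w \in S (t w) then q w else p w) (k w).
Proof.
rewrite -(prod_restr t (fun u w => frame1 C (if w \in S u then q w else p w) (k w))).
apply: eq_bigr => u _; apply: eq_bigr => w _.
by rewrite inE mixE !ffunE.
Qed.

Lemma contraction (S : V -> {set W})
    (N : forall u, idx d (inn u) -> idx d (inn u) -> idx d (out u) -> idx d (out u) -> C) :
  \sum_(p : fam (fun w => 'I_(dd w) : finType))
  \sum_(q : fam (fun w => 'I_(dd w) : finType))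
    \prod_u emb_tensor (S u) (@N u) (restr (inn u) p) (restr (inn u) q)
      (restr (out u) p) (restr (out u) q) =
  (\prod_w ((w \in S (tl w)) == (w \in S (hd w)))%:R) *
  \sum_(k : fam (fun w => 'I_(d w) : finType))
  \sum_(l : fam (fun w => 'I_(d w) : finType))
    \prod_u N u (restr (inn u) k) (restr (inn u) l) (restr (out u) k) (restr (out u) l).
Proof.
(* The local sums of all nodes become sums over global indices: [K], [L] for the incoming ends and
   [K'], [L'] for the outgoing ends. *)
under [LHS]eq_bigr => p _.
  under eq_bigr => q _.
    rewrite /emb_tensor prod_sum_restr.
    under eq_bigr => K _.
      rewrite prod_sum_restr.
      under eq_bigr => L _.
        rewrite prod_sum_restr.
        under eq_bigr => K' _.
          rewrite prod_sum_restr.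
          over.
        over.
      over.
    over.
  over.
rewrite exchange_big2 mulr_sumr; apply: eq_bigr => K _.
rewrite exchange_big2 mulr_sumr; apply: eq_bigr => L _.
rewrite exchange_big2.
pose c : C := \prod_w ((w \in S (tl w)) == (w \in S (hd w)))%:R.
pose NN K' L' := \prod_u N u (restr (inn u) K) (restr (inn u) L)
  (restr (out u) K') (restr (out u) L').
(* Summing over [p] and [q] first and regrouping the frame factors by wire, [frame1_wire] forces the
   indices at the two ends of each wire to coincide. *)
transitivity (\sum_K' \sum_L' c * ((K == K')%:R * (L == L')%:R) * NN K' L').
  apply: eq_bigr => K' _; rewrite exchange_big2; apply: eq_bigr => L' _.
  rewrite /c -!prod_delta -!big_split /=.
  under [X in _ = X * _]eq_bigr => w _ do rewrite -frame1_wire.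
  rewrite (dffun_distr (fun w a => \sum_b _)) mulr_suml; apply: eq_bigr => p _.
  rewrite (dffun_distr (fun w b => _)) mulr_suml; apply: eq_bigr => q _.
  by rewrite 4!big_split 3![in RHS]big_split /= -!rmorph_prod !prod_frame.
rewrite (bigD1 K) //= [X in _ + X]big1 ?addr0; last first.
  by move=> K' /negPf nK; rewrite big1 // => L' _; rewrite eq_sym nK mul0r mulr0 mul0r.
rewrite (bigD1 L) //= [X in _ + X]big1 ?addr0; last first.
  by move=> L' /negPf nL; rewrite [L == L']eq_sym nL !mulr0 mul0r.
by rewrite !eqxx !mulr1.
Qed.

End Contraction.

(** * Total weight of the consistent bit assignments *)

Section TotalWeight.
Variables (C : numFieldType) (V W Z : finType) (e : rel V) (tl hd : W -> V).
Variable key : V -> W -> Z.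
Hypotheses (e_acyclic : acyclic e) (e_wire : forall w, e (tl w) (hd w)).
Hypothesis key_inj : forall u, {in [set w | hd w == u] &, injective (key u)}.

(** The number of ancestors strictly increases along the arrows of an acyclic graph, which makes it
    a measure for induction. *)
Let rank u := #|[set v | connect e v u]|.

Let rank_lt u v : e u v -> (rank u < rank v)%N.
Proof.
move=> euv; apply/proper_card/properP; split.
  apply/subsetP => x; rewrite !inE => /connect_trans; apply; exact: connect1.
by exists v; rewrite inE ?connect0 // e_acyclic.
Qed.

(** The wire from which [u] reads its bit [z]; it is unique because keys are injective on incoming
    wires. *)
Let parent u z := [pick w | (hd w == u) && (key u w == z)].

Let parent_key w : parent (hd w) (key (hd w) w) = Some w.
Proof.
rewrite /parent; case: pickP => [w' /andP[hw' /eqP kw']|/(_ w)]; last by rewrite !eqxx.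
by congr Some; apply: key_inj kw'; rewrite inE.
Qed.

(* Adding to every bit that is read off a wire the bit written there turns the
   consistency conditions into "all bits that are read vanish"; along an acyclic
   network this substitution is invertible. *)
Let shift (Phi : {ffun V -> {set Z}}) : {ffun V -> {set Z}} :=
  [ffun u => [set z | (z \in Phi u) (+)
    (if parent u z is Some w then key (tl w) w \in Phi (tl w) else false)]].

(** By induction on [rank]: the bits at the tails of the incoming wires are already determined, so
    the added terms cancel. *)
Let shift_inj : injective shift.
Proof.
move=> Phi Phi' eqs; apply/ffunP => u.
have [n] := ubnP (rank u); elim: n u => // n IHn u lt_n.
apply/setP => z; move/ffunP/(_ u)/setP/(_ z): eqs; rewrite !ffunE !inE.
rewrite /parent; case: pickP => [w /andP[/eqP hw _]|_]; last by rewrite !addbF.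
rewrite (IHn (tl w)); first exact: addIb.
by rewrite ltnS in lt_n; apply: leq_trans lt_n; apply: rank_lt; rewrite -hw.
Qed.

Lemma total_weight :
  \sum_(Phi : {ffun V -> {set Z}})
    (\prod_u frame_wt C (fun i : {w | w \in [set w | hd w == u]} => key u (val i))) *
    \prod_w ((key (tl w) w \in Phi (tl w)) == (key (hd w) w \in Phi (hd w)))%:R = 1.
Proof.
pose g u (phi : {set Z}) : C :=
  frame_wt C (fun i : {w | w \in [set w | hd w == u]} => key u (val i)) *
  \prod_(i : {w | w \in [set w | hd w == u]}) (key u (val i) \notin phi)%:R.
(* After the substitution the conditions no longer couple different nodes. At each node a bit that
   is read then contributes 0 + 1, and the sum over the node is 1. *)
transitivity (\sum_(Phi : {ffun V -> {set Z}}) \prod_u g u (shift Phi u)).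
  apply: eq_bigr => Phi _; rewrite big_split; congr (_ * _).
  rewrite (prod_restr hd (fun u w => (key u w \notin shift Phi u)%:R)).
  apply: eq_bigr => w _; rewrite ffunE inE parent_key.
  by case: (_ \in _); case: (_ \in _).
transitivity (\sum_(Phi : {ffun V -> {set Z}}) \prod_u g u (Phi u)).
  by rewrite [RHS](reindex_inj shift_inj).
rewrite -(bigA_distr_bigA g) big1 // => u _.
rewrite /g (@sum_frame_wt _ _ _ _ (fun _ b => (~~ b)%:R)) ?add0r ?big1 //.
by move=> i j /(key_inj (valP i) (valP j)) /val_inj.
Qed.

End TotalWeight.

(** * Framed states, effects and maps as averages of framed tensors *)

Section NodeTensors.
Variables (R : realType) (W Z : finType) (d : W -> nat) (key : W -> Z).
Local Notation C := R[i].
Local Notation dd := (fun w => d w + d w)%N.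
Local Notation wt Din := (frame_wt C (fun i : {w : W | w \in Din} => key (val i))).

(** On the empty system there is a single index and the frame is 1. This supplies the missing side
    of the tensors of sources and parties. *)
Lemma sum_frame0 (p : idx dd finset.set0) (F : C) :
  \sum_(k : idx d finset.set0) frame R finset.set0 p k * F = F.
Proof.
have no (i : {w : W | w \in finset.set0}) : False by case: i => w; rewrite inE.
rewrite -mulr_suml -(dffun_distr (fun (i : {w : W | w \in finset.set0}) t =>
  if val i \in finset.set0 then (frame1 C (p i) t)^*%R else frame1 C (p i) t)).
by rewrite big1 ?mul1r // => i; case: (no i).
Qed.

Lemma sum_frame0_conj (p : idx dd finset.set0) (F : C) :
  \sum_(k : idx d finset.set0) (frame R finset.set0 p k)^*%R * F = F.
Proof.
rewrite -[RHS]mul1r -[X in X * _]conjC1 -[X in (X^*)%R](sum_frame0 p 1) raddf_sum mulr_suml.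
by apply: eq_bigr => k _; rewrite mulr1.
Qed.

(** A source has no incoming wires; the dummy indices [p0] and [q0] of the empty system give it the
    same tensor form as a box. *)
Lemma entry_frame_op (Din I D : {set W}) (A : op R d D) (p0 q0 : idx dd I) p q :
  I = finset.set0 -> entry (frame_op key Din A) p q = \sum_(phi : {set Z}) wt Din *
    emb_tensor (key @^-1: phi) (fun _ _ k l => entry A k l) p0 q0 p q.
Proof.
move=> I0; subst I.
rewrite entry_sum; apply: eq_bigr => phi _.
rewrite entryZ entry_ptrans entry_emb /emb_tensor; congr (_ * _).
rewrite -[LHS](sum_frame0 (mix (key @^-1: phi) q0 p0)).
rewrite -[LHS](sum_frame0_conj (mix (key @^-1: phi) p0 q0)).
apply: eq_bigr => k _; rewrite mulr_sumr; apply: eq_bigr => l _.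
rewrite !mulr_sumr; apply: eq_bigr => k' _; rewrite !mulr_sumr.
by apply: eq_bigr => l' _; ring.
Qed.

Lemma tr_mul_matunit (d' : W -> nat) (D : {set W}) (A : op R d' D) k l :
  \tr (A *m matunit R k l) = entry A l k.
Proof.
rewrite tr_mul_op (bigD1 l) //= [X in _ + X]big1 ?addr0; last first.
  move=> i /negPf nl; rewrite big1 // => j _.
  by rewrite entry_matunit nl mulr0 mulr0.
rewrite (bigD1 k) //= [X in _ + X]big1 ?addr0; last first.
  by move=> i /negPf nk; rewrite entry_matunit nk mul0r mulr0.
by rewrite entry_matunit !eqxx !mulr1.
Qed.

Lemma tr_frame_op (D O : {set W}) (E : op R d D) (p0 q0 : idx dd O) p q :
  O = finset.set0 -> \tr (frame_op key D E *m matunit R p q) = \sum_(phi : {set Z}) wt D *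
    emb_tensor (key @^-1: phi) (fun k l _ _ => \tr (E *m matunit R k l)) p q p0 q0.
Proof.
move=> O0; subst O.
rewrite tr_mul_matunit entry_sum; apply: eq_bigr => phi _.
rewrite entryZ entry_ptrans entry_emb /emb_tensor exchange_big; congr (_ * _).
apply: eq_bigr => k _; apply: eq_bigr => l _; rewrite tr_mul_matunit.
rewrite -[LHS](sum_frame0_conj (mix (key @^-1: phi) q0 p0)).
rewrite -[LHS](sum_frame0 (mix (key @^-1: phi) p0 q0)).
apply: eq_bigr => k' _; rewrite mulr_sumr; apply: eq_bigr => l' _; ring.
Qed.

Lemma entry_frame_map (Din D : {set W}) (Lam : op R d Din -> op R d D) p q p' q' :
  linear Lam ->
  entry (frame_map key Lam (matunit R p q)) p' q' = \sum_(phi : {set Z}) wt Din *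
    emb_tensor (key @^-1: phi)
      (fun k l k' l' => entry (Lam (matunit R k l)) k' l') p q p' q'.
Proof.
move=> lL; pose L : {linear _ -> _} := HB.pack Lam (GRing.isLinear.Build _ _ _ _ Lam lL).
rewrite entry_sum; apply: eq_bigr => phi _.
rewrite entryZ entry_ptrans entry_emb /emb_tensor; congr (_ * _).
rewrite ptrans_matunit.
(* Decoding a matrix unit yields a rank-one operator whose coefficients are products of frame
   entries; [Lam] acts on it by linearity. *)
have -> P Q : Lam (unemb finset.set0 (matunit R P Q)) = \sum_k \sum_l
    ((frame R finset.set0 P k)^*%R * frame R finset.set0 Q l) *: Lam (matunit R k l).
  rewrite [unemb _ _]op_sum_matunit -[LHS]/(L _) linear_sum; apply: eq_bigr => k _.
  rewrite linear_sum; apply: eq_bigr => l _; rewrite linearZ; congr (_ *: _).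
  rewrite entry_unemb (bigD1 P) //= [X in _ + X]big1 ?addr0; last first.
    move=> i /negPf nP; rewrite big1 // => j _.
    by rewrite entry_matunit nP mul0r mulr0 mul0r.
  rewrite (bigD1 Q) //= [X in _ + X]big1 ?addr0; last first.
    by move=> i /negPf nQ; rewrite entry_matunit nQ !mulr0 mul0r.
  by rewrite entry_matunit !eqxx !mulr1.
under eq_bigr => k' _.
  under eq_bigr => l' _.
    rewrite entry_sum mulr_sumr mulr_suml.
    under eq_bigr => k _ do rewrite entry_sum mulr_sumr mulr_suml.
    over.
  over.
rewrite exchange_big2; apply: eq_bigr => k _.
rewrite exchange_big2; apply: eq_bigr => l _.
apply: eq_bigr => k' _; apply: eq_bigr => l' _; rewrite entryZ; ring.
Qed.

End NodeTensors.

(** * The trace rule as a product of node tensors *)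

Section NodeProduct.
Variables (R : realType) (th : theory) (G : causal_structure) (r : realisation R th G).
Variables (x : fam (@setting G)) (o : fam (@outcome G)).

Definition node_tensor (u : node G) :
    idx (@dim _ _ _ r) (inw r u) -> idx (@dim _ _ _ r) (inw r u) ->
    idx (@dim _ _ _ r) (outw r u) -> idx (@dim _ _ _ r) (outw r u) -> R[i] :=
  match u return idx (@dim _ _ _ r) (inw r u) -> idx (@dim _ _ _ r) (inw r u) ->
    idx (@dim _ _ _ r) (outw r u) -> idx (@dim _ _ _ r) (outw r u) -> R[i] with
  | inl s => fun _ _ k' l' => entry (prep r s) k' l'
  | inr (inl b) => fun k l k' l' =>
      entry (inst r (seen (inl b) x o) (o (inl b)) (matunit R k l)) k' l'
  | inr (inr p) => fun k l _ _ =>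
      \tr (meas r (seen (inr p) x o) (o (inr p)) *m matunit R k l)
  end.

Lemma prob_node_tensor : prob r x o =
  \sum_k \sum_l \prod_u @node_tensor u (restr (inw r u) k) (restr (inw r u) l)
    (restr (outw r u) k) (restr (outw r u) l).
Proof.
apply: eq_bigr => k _; apply: eq_bigr => l _.
by rewrite big_sumType [X in _ = _ * X]big_sumType /= mulrA.
Qed.

End NodeProduct.

(** * Passage between real and complex realisations *)

Lemma is_state_T (R : realType) th (W : finType) (d : W -> nat) (D : {set W}) (rho : op R d D) :
  is_state th rho -> is_state T rho.
Proof. by case. Qed.

Lemma is_measurement_T (R : realType) th (W : finType) (d : W -> nat) (D : {set W})
    (O : finType) (E : O -> op R d D) :
  is_measurement th E -> is_measurement T E.
Proof. by case=> eE sE; split=> // o; case: (eE o). Qed.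

Lemma is_instrument_T (R : realType) th (W L : finType) (d : W -> nat) (lab : W -> L)
    (D D' : {set W}) (O : finType) (Lam : O -> op R d D -> op R d D') :
  is_instrument th lab Lam -> is_instrument T lab Lam.
Proof.
by case=> iL [pL tL _]; split; [move=> o; case: (iL o) => cL nL _; split|split].
Qed.

Definition complex_realisation (R : realType) (G : causal_structure)
    (r : realisation R sT G) : realisation R T G :=
  @Realisation R T G (wire r) (label r) (@dim _ _ _ r) (@lab _ _ _ r)
    (@tail _ _ _ r) (@head _ _ _ r) (prep r) (@inst _ _ _ r) (@meas _ _ _ r)
    (@wire_arrow _ _ _ r) (@box_wire _ _ _ r) (@lab_in _ _ _ r) (@lab_out _ _ _ r)
    (fun s => is_state_T (prep_state r s))
    (fun b t => is_instrument_T (@inst_instrument _ _ _ r b t))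
    (fun p t => is_measurement_T (@meas_measurement _ _ _ r p t)).

Section RealRealisation.
Variables (R : realType) (G : causal_structure) (r : realisation R T G).
Local Notation Z := (option (label r + wire r))%type.

(* A source has a single bit, a box one bit for each label (shared by its incoming and
   outgoing wires with that label), and a party one bit for each wire. *)
Definition frame_key (u : node G) (w : wire r) : Z :=
  match u with
  | inl _ => None
  | inr (inl _) => Some (inl (lab w))
  | inr (inr _) => Some (inr w)
  end.

Lemma frame_key_inj u : {in inw r u &, injective (frame_key u)}.
Proof.
case: u => [s|[b|p]] w w' /=.
- by rewrite inE => /eqP hw; have := source_no_incoming (tail w) s; rewrite -hw wire_arrow.
- by move=> wb wb' [] /(lab_in wb wb').
- by move=> _ _ [].
Qed.

Lemma inw_source s : inw r (inl s) = finset.set0.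
Proof.
apply/setP => w; rewrite !inE; apply/eqP => hw.
by have := source_no_incoming (tail w) s; rewrite -hw wire_arrow.
Qed.

Lemma outw_party p : outw r (inr (inr p)) = finset.set0.
Proof.
apply/setP => w; rewrite !inE; apply/eqP => hw.
by have := party_no_outgoing p (head w); rewrite -hw wire_arrow.
Qed.

Lemma prep_real s :
  is_state sT (frame_op (frame_key (inl s)) (inw r (inl s)) (prep r s)).
Proof.
rewrite inw_source; apply: (@frame_op_state _ _ _ _ _ T _ None) => //.
exact: prep_state.
Qed.

Lemma inst_real b t : is_instrument sT (@lab _ _ _ r)
  (fun c => frame_map (frame_key (inr (inl b))) (inst r (b := b) t c)).
Proof.
apply: (@frame_map_instrument _ _ _ _ _ T _ _ (fun l => Some (inl l))) => //.
  exact: frame_key_inj.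
exact: inst_instrument.
Qed.

Lemma meas_real p t : is_measurement sT
  (fun c => frame_op (frame_key (inr (inr p))) (inw r (inr (inr p))) (meas r (p := p) t c)).
Proof.
apply: (@frame_op_measurement _ _ _ _ _ T); first exact: frame_key_inj.
exact: meas_measurement.
Qed.

Definition real_realisation : realisation R sT G :=
  @Realisation R sT G (wire r) (label r) (fun w => dim w + dim w)%N (@lab _ _ _ r)
    (@tail _ _ _ r) (@head _ _ _ r) _ _ _
    (@wire_arrow _ _ _ r) (@box_wire _ _ _ r) (@lab_in _ _ _ r) (@lab_out _ _ _ r)
    prep_real inst_real meas_real.

Lemma prob_real x o : prob real_realisation x o = prob r x o.
Proof.
rewrite !prob_node_tensor.
pose key (u : node G) := frame_key u.
pose wt u : R[i] := frame_wt R[i] (fun i : {w | w \in inw r u} => key u (val i)).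
pose Nr (u : node G) := @node_tensor R T G r x o u.
have step u p q p' q' : @node_tensor R sT G real_realisation x o u p q p' q' =
    \sum_(phi : {set Z}) wt u * emb_tensor (key u @^-1: phi) (@Nr u) p q p' q'.
  case: u p q p' q' => [s|[b|v]] p q p' q' /=.
  - exact: (entry_frame_op _ _ _ _ _ _ _ (inw_source s)).
  - apply: entry_frame_map.
    by have [/(_ (o (inl b)))[[]]] := @inst_instrument R T G r b (seen (inl b) x o).
  - exact: (tr_frame_op _ _ _ _ _ _ (outw_party v)).
(* Each node averages over bits of its own; distributivity gathers them into one assignment [Phi]
   for the whole network. *)
transitivity (\sum_(Phi : {ffun node G -> {set Z}}) (\prod_u wt u) *
    \sum_p \sum_q \prod_u emb_tensor (key u @^-1: Phi u) (@Nr u)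
      (restr (inw r u) p) (restr (inw r u) q) (restr (outw r u) p) (restr (outw r u) q)).
  transitivity (\sum_(Phi : {ffun node G -> {set Z}}) \sum_p \sum_q (\prod_u wt u) *
    \prod_u emb_tensor (key u @^-1: Phi u) (@Nr u)
      (restr (inw r u) p) (restr (inw r u) q) (restr (outw r u) p) (restr (outw r u) q));
    last first.
    apply: eq_bigr => Phi _; rewrite mulr_sumr; apply: eq_bigr => p _.
    by rewrite mulr_sumr.
  rewrite -exchange_big2; apply: eq_bigr => p _; apply: eq_bigr => q _.
  under eq_bigr => u _ do rewrite step.
  rewrite bigA_distr_bigA; apply: eq_bigr => Phi _; exact: big_split.
(* By [contraction], every [Phi] yields the original probability times its consistency factor, so
   only the total weight remains to be evaluated. *)
have weight := total_weight R[i] (@arrows_acyclic G) (tl := @tail _ _ _ r) _ frame_key_inj.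
rewrite -[RHS]mul1r -[X in _ = X * _]weight; last first.
  by move=> w; rewrite /= wire_arrow.
rewrite mulr_suml; apply: eq_bigr => Phi _.
rewrite (contraction (fun u => key u @^-1: Phi u) Nr) mulrA; congr (_ * _ * _).
by apply: eq_bigr => w _; rewrite !inE.
Qed.

End RealRealisation.

Theorem theorem13 (R : realType) :
  (forall G : causal_structure, corr R T G = corr R sT G) /\
  ~ (exists G : causal_structure, (corr R sT G `<` corr R T G)%classic).
Proof.
have corrE G : corr R T G = corr R sT G.
  apply/seteqP; split=> P [r Pr].
    by exists (real_realisation r) => x o; rewrite prob_real.
  exists (complex_realisation r) => x o; rewrite Pr; exact: esym.
by split=> // -[G]; rewrite corrE => -[_]; apply.
Qed.
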